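(* Let $n \geq 3$ and $0<p<n-2$. Suppose the compact set $K \subset \mathbb{R}^n$ and closed ball $B \subset \mathbb{R}^n$ centered at the origin have the same $p$-capacity, $\mathrm{Cap}_p(K)=\mathrm{Cap}_p(B)>0$, and let $\mu$ and $\nu$ be the $p$-equilibrium measures of $K$ and $B$, respectively. If the equilibrium moment inequality $$\int_K |x|^q \, d\mu \geq \int_B |x|^q \, d\nu$$ holds for some $q=q_* \in (0,\infty)$ then it holds for all $q \in [q_*,\infty)$.
   Context: For a compact set $K \subset \mathbb{R}^n$ and $p>0$, the Riesz $p$-energy is $V_p(K)=\inf_\mu \int_K\int_K \frac{1}{|x-y|^p}\,d\mu(x)d\mu(y)$, where the infimum is over all Borel probability measures $\mu$ on $K$ (the energy of the empty set is $+\infty$). The infimum is attained, and when the energy is finite the minimizing measure is unique; it is called the $p$-equilibrium measure of $K$. The Riesz $p$-capacity is $\mathrm{Cap}_p(K)=V_p(K)^{-1/p}$; it is positive if and only if $V_p(K)<\infty$. *)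

(* Defs.v *)
From HB Require Import structures.
From mathcomp Require Import all_boot all_order all_algebra.
From mathcomp Require Import all_classical all_reals all_analysis.
Import Order.TTheory GRing.Theory Num.Theory.
Import numFieldNormedType.Exports.

Set Implicit Arguments.
Unset Strict Implicit.
Unset Printing Implicit Defensive.

Local Open Scope classical_set_scope.
Local Open Scope ring_scope.
Local Open Scope ereal_scope.

(* R^n with its Borel sigma-algebra. The library's norm on ['rV[R]_n] is the
   sup norm; it is used here only through the topology, which is the
   Euclidean one. *)
Definition borel_space (R : realType) (n : nat) :=
  g_sigma_algebraType (@open 'rV[R]_n).

Definition enorm (R : realType) (n : nat) (x : 'rV[R]_n) : R :=
  Num.sqrt (\sum_(i < n) x ord0 i ^+ 2)%R.

Definition eball (R : realType) (n : nat) (r : R) : set 'rV[R]_n :=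
  [set x | (enorm x <= r)%R].

(* The inverse is taken in [\bar R], where [0^-1 = +oo]: the kernel is +oo on
   the diagonal. A negative real power would be wrong, as [0 `^ (- p) = 0]. *)
Definition riesz_kernel (R : realType) (n : nat) (p : R) (x y : 'rV[R]_n) :
    \bar R :=
  ((enorm (x - y)%R `^ p)%:E)^-1.

(* Borel probability measures on K, seen as measures on R^n carried by K. *)
Definition prob_on (R : realType) (n : nat) (K : set 'rV[R]_n) :
    set (probability (borel_space R n) R) :=
  [set mu | mu K = 1].

Definition riesz_integral (R : realType) (n : nat) (p : R)
    (K : set 'rV[R]_n) (mu : probability (borel_space R n) R) : \bar R :=
  \int[mu]_(x in K) \int[mu]_(y in K) riesz_kernel p x y.

Definition riesz_energy (R : realType) (n : nat) (p : R)
    (K : set 'rV[R]_n) : \bar R :=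
  ereal_inf [set riesz_integral p K mu | mu in prob_on K].

(* V ^ (-1/p), again through the inverse of [\bar R], so that infinite energy
   gives capacity 0. *)
Definition riesz_capacity (R : realType) (n : nat) (p : R)
    (K : set 'rV[R]_n) : \bar R :=
  (riesz_energy p K `^ p^-1)^-1.

Definition equilibrium_measure (R : realType) (n : nat) (p : R)
    (K : set 'rV[R]_n) (mu : probability (borel_space R n) R) : Prop :=
  prob_on K mu /\ riesz_integral p K mu = riesz_energy p K.

Definition moment (R : realType) (n : nat) (q : R)
    (K : set 'rV[R]_n) (mu : probability (borel_space R n) R) : \bar R :=
  \int[mu]_(x in K) (enorm (x : 'rV[R]_n) `^ q)%:E.

(* Main.v *)
From HB Require Import structures.
Require Import Defs.
From mathcomp Require Import all_boot all_order all_algebra.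
From mathcomp Require Import all_classical all_reals all_analysis.
From mathcomp Require Import measurable_realfun ring lra.
Import Order.TTheory GRing.Theory Num.Theory.
Import numFieldNormedType.Exports.

(** The heart of the matter is that, for [p < n - 2], the equilibrium measure
    [nu] of a ball of radius [r] lives on the bounding sphere
    ([equilibrium_eball_sphere]). Then every moment of [nu] is a pure power,
    [moment q nu = r `^ q], and the claim becomes the monotonicity of [L^q]
    norms of [|x|] under the probability [mu]: Young's inequality bounds
    [|x| `^ q] from below by an affine function of [|x| `^ qs] that is tangent
    to it at [|x| = r], and integrating this against [mu] gives the result
    ([moment_ge_powR]).

    That [nu] lives on the sphere reflects the strict superharmonicity of
    [|x| `^ (- p)] for [p < n - 2]. The classical route sweeps [nu] onto the
    sphere with the Poisson kernel; the argument below only uses push-forwards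
    under finitely many explicit maps and the second variation of the energy.
    Let [T s i] move [x] by [s (r - |x|)] along the [i]-th coordinate axis.
    For [|s| <= 1] it maps the ball into itself, so no push-forward of [nu]
    under [T s i] has less energy than [nu]. On the other hand
    [T s i x - T s i y = (x - y) + s (|y| - |x|) e_i], a relative perturbation
    of [x - y] of size at most [s], uniformly in [x] and [y]: the singularity
    of the kernel on the diagonal is harmless. Summing the Taylor expansions of
    the kernel over all [i] and over [s = e], [s = - e], first-order terms
    cancel and second-order ones add up to a negative multiple of
    [(|x| - |y|)^2 |x - y| `^ (- p - 2)], because the Laplacian of
    [|w| `^ (- p)] is [- p (n - 2 - p) |w| `^ (- p - 2)]. As the energy is
    finite and minimal, this second-order term integrates to [0], that is,
    [|x| = |y|] for almost all [x] and [y]. So [nu] lives on one sphere centred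
    at the origin. If its radius were less than [r], a dilation that stays in
    the ball would divide the energy, which is positive and finite, by a
    number greater than [1]. *)

Set Implicit Arguments.
Unset Strict Implicit.
Unset Printing Implicit Defensive.

Local Open Scope classical_set_scope.
Local Open Scope ring_scope.

(** * The Euclidean norm *)

Definition sqnorm (R : realType) (n : nat) (x : 'rV[R]_n) : R :=
  \sum_(i < n) x ord0 i ^+ 2.

Lemma sqnorm_ge0 (R : realType) (n : nat) (x : 'rV[R]_n) : 0 <= sqnorm x.
Proof. by apply: sumr_ge0 => i _; exact: sqr_ge0. Qed.

Lemma enorm_ge0 (R : realType) (n : nat) (x : 'rV[R]_n) : 0 <= enorm x.
Proof. exact: sqrtr_ge0. Qed.

Lemma sqr_enorm (R : realType) (n : nat) (x : 'rV[R]_n) :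
  enorm x ^+ 2 = sqnorm x.
Proof. by rewrite sqr_sqrtr// sqnorm_ge0. Qed.

Lemma enorm_eq0 (R : realType) (n : nat) (x : 'rV[R]_n) :
  (enorm x == 0) = (x == 0).
Proof.
rewrite -sqrf_eq0 sqr_enorm /sqnorm psumr_eq0; last first.
  by move=> i _; exact: sqr_ge0.
apply/allP/eqP => [h|-> i _]; last first.
  by rewrite mxE expr0n /= eqxx.
apply/rowP => i; have := h i; rewrite mem_index_enum sqrf_eq0 mxE.
by move=> /(_ isT)/eqP.
Qed.

Lemma enormZ (R : realType) (n : nat) (k : R) (x : 'rV[R]_n) :
  enorm (k *: x) = `|k| * enorm x.
Proof.
rewrite /enorm -sqrtr_sqr -sqrtrM ?sqr_ge0// mulr_sumr; congr Num.sqrt.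
by apply: eq_bigr => i _; rewrite mxE exprMn.
Qed.

Lemma enormN (R : realType) (n : nat) (x : 'rV[R]_n) : enorm (- x) = enorm x.
Proof. by rewrite -scaleN1r enormZ normrN1 mul1r. Qed.

(** Each coordinate satisfies [2 u v <= (b / a) u^2 + (a / b) v^2] with
    [a = |x|] and [b = |y|]; their sum is the Cauchy-Schwarz inequality. *)
Lemma ler_enormD (R : realType) (n : nat) (x y : 'rV[R]_n) :
  enorm (x + y) <= enorm x + enorm y.
Proof.
have [/eqP|x0] := eqVneq (enorm x) 0.
  by rewrite enorm_eq0 => /eqP ->; rewrite add0r lerDr enorm_ge0.
have [/eqP|y0] := eqVneq (enorm y) 0.
  by rewrite enorm_eq0 => /eqP ->; rewrite addr0 lerDl enorm_ge0.
have {}x0 : 0 < enorm x by rewrite lt_def x0 enorm_ge0.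
have {}y0 : 0 < enorm y by rewrite lt_def y0 enorm_ge0.
rewrite -(@ler_pXn2r _ 2) ?nnegrE ?addr_ge0 ?enorm_ge0//.
have le_sum : sqnorm (x + y) <= \sum_(i < n)
    ((1 + enorm y / enorm x) * x ord0 i ^+ 2 +
     (1 + enorm x / enorm y) * y ord0 i ^+ 2).
  apply: ler_sum => i _; rewrite !mxE -subr_ge0.
  set a := enorm x; set b := enorm y; set u := x _ _; set v := y _ _.
  have -> : (1 + b / a) * u ^+ 2 + (1 + a / b) * v ^+ 2 - (u + v) ^+ 2
      = (b * u - a * v) ^+ 2 / (a * b) by field; rewrite !gt_eqF.
  by rewrite divr_ge0 ?sqr_ge0// mulr_ge0 ?enorm_ge0.
rewrite sqr_enorm (le_trans le_sum)// big_split/= -!mulr_sumr.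
rewrite -/(sqnorm x) -/(sqnorm y) -!sqr_enorm.
by rewrite le_eqVlt; apply/orP; left; apply/eqP; field; rewrite !gt_eqF.
Qed.

Lemma ler_dist_enorm (R : realType) (n : nat) (x y : 'rV[R]_n) :
  `|enorm x - enorm y| <= enorm (x - y).
Proof.
rewrite ler_norml; apply/andP; split.
  have := ler_enormD (y - x) x; rewrite subrK -opprB enormN; lra.
by have := ler_enormD (x - y) y; rewrite subrK; lra.
Qed.

Lemma enorm_delta (R : realType) (n : nat) (i : 'I_n) :
  enorm (delta_mx ord0 i : 'rV[R]_n) = 1.
Proof.
rewrite /enorm (bigD1 i)//= big1 => [|j ji]; rewrite mxE eqxx/=.
  by rewrite eqxx addr0 expr1n sqrtr1.
by rewrite (negPf ji) expr0n.
Qed.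

Lemma sqnormD_delta (R : realType) (n : nat) (w : 'rV[R]_n) (s : R) (i : 'I_n) :
  sqnorm (w + s *: delta_mx ord0 i) = sqnorm w + 2 * s * w ord0 i + s ^+ 2.
Proof.
rewrite /sqnorm (bigD1 i)//= [in RHS](bigD1 i)//= !mxE !eqxx mulr1.
rewrite (eq_bigr (fun j => w ord0 j ^+ 2)) => [|j ji]; first by ring.
by rewrite !mxE (negPf ji) andbF mulr0 addr0.
Qed.

Lemma enorm_powR (R : realType) (n : nat) (p : R) (x : 'rV[R]_n) :
  enorm x `^ p = sqnorm x `^ (p / 2).
Proof. by rewrite /enorm -powR12_sqrt ?sqnorm_ge0// -powRrM mulrC. Qed.

Lemma continuous_enorm (R : realType) (n : nat) :
  continuous (@enorm R n : 'rV[R]_n -> R).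
Proof.
move=> x; apply: (@continuous_comp _ _ _ (@sqnorm R n)); last first.
  exact: sqrt_continuous.
move: x; apply: continuous_big => [|i _ x].
  by move=> z; apply: cvgD; [exact: cvg_fst|exact: cvg_snd].
apply: (@continuous_comp _ _ _ (fun x : 'rV[R]_n => x ord0 i)
  (fun t => t ^+ 2)).
  exact: coord_continuous.
exact: exprn_continuous.
Qed.

(** * Inequalities for real powers *)

Lemma powRN_ge_tangent (R : realType) (c u : R) : 0 <= c -> 0 < 1 + u ->
  1 - c * u <= (1 + u) `^ (- c).
Proof.
move=> c0 u0; rewrite /powR gt_eqF//.
apply: le_trans (expR_ge1Dx _).
by rewrite mulNr lerD2l lerN2 ler_wpM2l// le_ln1Dx//; lra.
Qed.

(** The second-order Taylor polynomial of [(1 + u) `^ (- a)] at [0] has leading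
    coefficient [a (a + 1) / 2]; any larger [b] absorbs the remainder near [0].
    The difference [f] of the two sides vanishes at [0], and the tangent bound,
    at [u] for [u >= 0] and at [(1 + u)^-1 - 1] for [u < 0], shows that [f']
    has the sign of [u]. *)
Lemma powRN_le_quadratic (R : realType) (a b : R) : 0 < a ->
  a * (a + 1) / 2 < b ->
  exists2 d : R, 0 < d < 1 &
    forall u, `|u| <= d -> (1 + u) `^ (- a) <= 1 - a * u + b * u ^+ 2.
Proof.
move=> a0 ab.
(* The sign of [f'] is that of [(1 + u) `^ (- (a + 1)) - (1 - k u)]. For [u < 0]
   the excess of [k] over [a + 1] must cover the error of the tangent bound;
   [d] is the radius up to which it does. *)
pose k := 2 * b / a.
have kc : a + 1 < k by rewrite /k ltr_pdivlMr//; lra.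
have ka : k * a = 2 * b by rewrite /k; field; rewrite gt_eqF.
move: k kc ka => k kc ka.
have [d d0 kd] : exists2 d : R, 0 < d & k * (a + 2) * d = k - (a + 1).
  have k0 : 0 < k by lra.
  have a2 : 0 < a + 2 by lra.
  exists ((k - (a + 1)) / (k * (a + 2))); last by field; rewrite !gt_eqF.
  by rewrite divr_gt0 ?mulr_gt0// subr_gt0.
have d1 : d * (a + 2) < 1 by nra.
have d1' : d < 1 by nra.
exists d; first by rewrite d0.
move=> u.
pose f : R -> R := fun x => 1 - a * x + b * x ^+ 2 - (1 + x) `^ (- a).
have df (x : R) : - d <= x <= d ->
    is_derive x 1 f (- a + 2 * b * x + a * (1 + x) `^ (- (a + 1))).
  move=> /andP[x1 x2].
  have x0 : 0 < 1 + x by lra.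
  have Hp : is_derive x (1:R) (fun x : R => (1 + x) `^ (- a))
      (- a * (1 + x) `^ (- (a + 1))).
    rewrite -[X in is_derive _ _ X]/((@powR R ^~ (- a)) \o (fun x => 1 + x)).
    apply: is_derive_eq; first apply: is_derive1_comp.
    - exact: is_derive1_powR.
    - by rewrite add0r !mulr1 opprD.
  rewrite /f; apply: is_derive_eq.
  by rewrite /GRing.scale/=; ring.
have fc (x y : R) : - d <= x -> y <= d -> {within `[x, y], continuous f}.
  move=> dx yd; apply: derivable_within_continuous => z.
  rewrite in_itv/= => /andP[xz zy].
  by have [] : is_derive z 1 f _ := df z ltac:(lra).
have fd (x y z : R) : - d <= x -> y <= d -> z \in `]x, y[ -> derivable f z 1.
  move=> dx yd; rewrite in_itv/= => /andP[xz zy].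
  by have [] : is_derive z 1 f _ := df z ltac:(lra).
have f' (z : R) : - d <= z <= d ->
    derive1 f z = - a + 2 * b * z + a * (1 + z) `^ (- (a + 1)).
  by move=> zd; rewrite derive1E; have [] : is_derive z 1 f _ := df z zd.
have f0 : f 0 = 0.
  by rewrite /f addr0 powR1 mulr0 expr0n/= mulr0 subr0 addr0 subrr.
rewrite ler_norml => /andP[ud1 ud2].
suff : f 0 <= f u by rewrite f0 /f; lra.
have [u0|u0] := leP 0 u.
  have f'0 z : z \in `]0, d[ -> 0 <= derive1 f z.
    rewrite in_itv/= => /andP[z0 zd]; rewrite f'; last lra.
    have := @powRN_ge_tangent _ (a + 1) z ltac:(lra) ltac:(lra).
    by nra.
  have f0d : {within `[0, d], continuous f} by apply: fc; lra.
  have f1d z : z \in `]0, d[ -> derivable f z 1 by apply: fd; lra.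
  have i0 : 0 \in `[0, d] by rewrite in_itv/=; lra.
  have iu : u \in `[0, d] by rewrite in_itv/=; lra.
  exact: (ger0_derive1_le_cc f1d f'0 f0d i0 iu u0).
have f'0 z : z \in `](- d), 0[ -> derive1 f z <= 0.
  rewrite in_itv/= => /andP[z0 zd]; rewrite f'; last lra.
  have z1 : 0 < 1 + z by lra.
  have zc : 0 < 1 + z + (a + 1) * z by nra.
  have := @powRN_ge_tangent _ (a + 1) (- z / (1 + z)) ltac:(lra).
  have -> : 1 + - z / (1 + z) = (1 + z)^-1 by field; rewrite gt_eqF.
  rewrite invr_gt0 => /(_ z1).
  have -> : ((1 + z)^-1) `^ (- (a + 1)) = (1 + z) `^ (a + 1).
    by rewrite -powR_inv1 ?(ltW z1)// -powRrM mulN1r opprK.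
  have -> : 1 - (a + 1) * (- z / (1 + z)) = (1 + z + (a + 1) * z) / (1 + z).
    by field; rewrite gt_eqF.
  rewrite ler_pdivrMr// => H.
  have P0 := powR_gt0 (a + 1) z1.
  rewrite powRN.
  have PV : (1 + z) `^ (a + 1) * ((1 + z) `^ (a + 1))^-1 = 1.
    by rewrite divff ?gt_eqF.
  have V0 : 0 < ((1 + z) `^ (a + 1))^-1 by rewrite invr_gt0.
  move: H P0 PV V0; set P := _ `^ _; set V := _^-1.
  move: P V => P V H P0 PV V0.
  have H1 : (1 + z + (a + 1) * z) * V <= 1 + z.
    by have := ler_wpM2r (ltW V0) H; nra.
  have : V <= 1 - k * z.
    rewrite -(ler_pM2l zc) (le_trans H1)// -subr_ge0.
    have -> : (1 + z + (a + 1) * z) * (1 - k * z) - (1 + z)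
        = k * (a + 2) * (d + z) * (- z).
      have := congr1 ( *%R (- z)) kd.
      by rewrite (_ : k * (a + 2) * (d + z) * - z = - z * (k * (a + 2) * d)
        - k * (a + 2) * z ^+ 2) => [->|]; ring.
    by rewrite !mulr_ge0//; lra.
  move=> /(ler_wpM2l (ltW a0)); rewrite mulrBr mulr1 mulrA [a * k]mulrC ka; lra.
have f0d : {within `[- d, 0], continuous f} by apply: fc; lra.
have f1d z : z \in `](- d), 0[ -> derivable f z 1 by apply: fd; lra.
have i0 : 0 \in `[- d, 0] by rewrite in_itv/=; lra.
have iu : u \in `[- d, 0] by rewrite in_itv/=; lra.
exact: (ler0_derive1_le_cc f1d f'0 f0d i0 iu (ltW u0)).
Qed.

(** Young's inequality for the exponents [b / a] and [b / (b - a)]. It is an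
    equality at [t = r]. *)
Lemma powR_young (R : realType) (a b r t : R) :
  0 < a -> a < b -> 0 < r -> 0 <= t ->
  b / a * r `^ (b - a) * t `^ a <= t `^ b + (b / a - 1) * r `^ b.
Proof.
move=> a0 ab r0 t0.
have b0 : 0 < b by lra.
have ba : 0 < b - a by lra.
have := @conjugate_powR R (t `^ a) (r `^ (b - a)) (b / a) (b / (b - a))
  (powR_ge0 _ _) (powR_ge0 _ _) (divr_gt0 b0 a0) (divr_gt0 b0 ba).
rewrite -!powRrM.
have -> : a * (b / a) = b by field; rewrite gt_eqF.
have -> : (b - a) * (b / (b - a)) = b by field; rewrite gt_eqF.
have -> : (b / a)^-1 + (b / (b - a))^-1 = 1 by field; rewrite !gt_eqF.
move=> /(_ erefl) /(ler_wpM2l (ltW (divr_gt0 b0 a0))).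
congr (_ <= _); first by ring.
by field; rewrite !gt_eqF.
Qed.

(** * Superharmonicity of the Riesz kernel *)

(** A quantitative, discrete form of [Delta |w| `^ (- p) < 0] for [p < n - 2].
    The step [s] is only bounded relative to [|w|], so the inequality stays
    valid up to the singularity. With [a = p / 2] and [N = |w|^2], the terms
    are [N `^ (- a) (1 + u) `^ (- a)] where [u = (2 s w_i + s^2) / N]; in the
    sum over both signs and all [i], the coefficient of [s^2 / N] in the
    quadratic bound is [8 b - 2 n a], which tends to [- 2 a (n - 2 - p)] as [b]
    decreases to [a (a + 1) / 2]. *)
Lemma riesz_superharmonic (R : realType) (n : nat) (p : R) :
  0 < p -> p < n%:R - 2 ->
  exists e c : R, [/\ 0 < e, e < 1, 0 < c &
    forall (w : 'rV[R]_n) (s : R), w != 0 -> `|s| <= e * enorm w ->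
    \sum_(i < n) (enorm (w + s *: delta_mx ord0 i) `^ (- p) +
                  enorm (w - s *: delta_mx ord0 i) `^ (- p)) +
      c * (s ^+ 2 * enorm w `^ (- p - 2))
    <= 2 * n%:R * enorm w `^ (- p)].
Proof.
move=> p0 pn.
pose a := p / 2; pose g := n%:R - 2 - p.
have a0 : 0 < a by rewrite /a; lra.
have g0 : 0 < g by rewrite /g; lra.
(* The excess of [b] over [a (a + 1) / 2] spends half of the available gap
   [a g]; the fourth-order term in [s] may spend half of the rest. *)
pose b := a * (a + 1) / 2 + a * g / 8.
have ab : a * (a + 1) / 2 < b by rewrite /b; nra.
have [d /andP[d0 d1] H] := powRN_le_quadratic a0 ab.
have n0 : 0 < n%:R :> R by lra.
have b0 : 0 < b by nra.
have bnE : n%:R * a - 4 * b = a * g / 2 by rewrite /b /g /a; field.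
have [e [e0 ed ne]] : exists e : R,
    [/\ 0 < e, 3 * e <= d & 2 * n%:R * b * e <= a * g / 2].
  have D0 : 0 < 4 * b * n%:R by rewrite !mulr_gt0.
  exists (Num.min (d / 3) (a * g / (4 * b * n%:R))); split.
  - by rewrite lt_min !divr_gt0// mulr_gt0.
  - by rewrite mulrC -ler_pdivlMr// ge_min lexx.
  - have : Num.min (d / 3) (a * g / (4 * b * n%:R)) <= a * g / (4 * b * n%:R).
      by rewrite ge_min lexx orbT.
    by rewrite ler_pdivlMr//; lra.
have e1 : e < 1 by lra.
exists e, (a * g / 2); split => //; first by rewrite divr_gt0 ?mulr_gt0.
move=> w s w0 sw.
set A := enorm w in sw *; set N := sqnorm w.
have A0 : 0 < A by rewrite lt_def enorm_ge0 enorm_eq0 w0.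
have AN : A ^+ 2 = N by rewrite /A sqr_enorm.
have N0 : 0 < N by rewrite -AN exprn_gt0.
have wA (i : 'I_n) : `|w ord0 i| <= A.
  rewrite -(@ler_pXn2r _ 2) ?nnegrE ?(ltW A0)// real_normK ?num_real// AN /N.
  by rewrite /sqnorm (bigD1 i)//= lerDl sumr_ge0// => j _; exact: sqr_ge0.
have s2 : s ^+ 2 <= e * N.
  rewrite -real_normK ?num_real// -AN expr2.
  apply: (@le_trans _ _ ((e * A) * (e * A))); first by rewrite ler_pM.
  rewrite expr2; have : 0 < A * A by nra.
  nra.
have one (t : R) (i : 'I_n) : `|t| = `|s| ->
  enorm (w + t *: delta_mx ord0 i) `^ (- p) <=
  A `^ (- p) * (1 - a * ((2 * t * w ord0 i + t ^+ 2) / N) +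
     b * ((2 * t * w ord0 i + t ^+ 2) / N) ^+ 2).
  move=> ts; rewrite [enorm _ `^ _]enorm_powR [A `^ _]enorm_powR -/N.
  set u := (_ + _) / N.
  have -> : sqnorm (w + t *: delta_mx ord0 i) = N * (1 + u).
    by rewrite sqnormD_delta -/N /u; field; rewrite gt_eqF.
  have tw : `|2 * t * w ord0 i| <= 2 * (e * N).
    rewrite -mulrA normrM ger0_norm// ler_pM2l// normrM ts -AN expr2 mulrA.
    by rewrite ler_pM.
  have t2 : `|t ^+ 2| <= e * N.
    by rewrite normrX ts -normrX ger0_norm ?sqr_ge0.
  have ud : `|u| <= d.
    rewrite /u normrM [`|N^-1|]ger0_norm ?invr_ge0 ?(ltW N0)// ler_pdivrMr//.
    apply: (le_trans (ler_normD _ _)); nra.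
  have u1 : 0 <= 1 + u by move: ud; rewrite ler_norml => /andP[]; lra.
  rewrite powRM ?(ltW N0)//.
  by rewrite mulNr ler_wpM2l ?powR_ge0// H.
have A2 : A `^ (- p - 2) = A `^ (- p) / N.
  rewrite powRB; last by rewrite (gt_eqF A0) implybT.
  by rewrite powR_mulrn ?(ltW A0)// AN.
(* The sum over the two signs of the quadratic bound is affine in
   [w_i ^+ 2]. *)
pose C := 2 - 2 * a * s ^+ 2 / N + 2 * b * s ^+ 4 / N ^+ 2.
pose D := 8 * b * s ^+ 2 / N ^+ 2.
pose T i := A `^ (- p) * (C + D * w ord0 i ^+ 2).
have sumT : \sum_(i < n) T i = A `^ (- p) * (2 * n%:R -
   s ^+ 2 / N * (a * g - 2 * n%:R * b * (s ^+ 2 / N))).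
  have -> : \sum_(i < n) T i = A `^ (- p) * (C * n%:R + D * N).
    rewrite /T -mulr_sumr big_split/= -mulr_sumr; congr (_ * (_ + _)).
    by rewrite sumr_const card_ord mulr_natr.
  congr (_ * _).
  have -> : a * g = 2 * (n%:R * a - 4 * b) by rewrite bnE; field.
  by rewrite /C /D; field; rewrite gt_eqF.
apply: (@le_trans _ _ (\sum_(i < n) T i +
    a * g / 2 * (s ^+ 2 * (A `^ (- p - 2))))).
  rewrite lerD2r; apply: ler_sum => i _.
  apply: (@le_trans _ _ (A `^ (- p) *
     (1 - a * ((2 * s * w ord0 i + s ^+ 2) / N) +
     b * ((2 * s * w ord0 i + s ^+ 2) / N) ^+ 2) +
     A `^ (- p) * (1 - a * ((2 * (- s) * w ord0 i + (- s) ^+ 2) / N) +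
     b * ((2 * (- s) * w ord0 i + (- s) ^+ 2) / N) ^+ 2))).
    by apply: lerD; [|rewrite -scaleNr]; apply: one; rewrite ?normrN.
  rewrite /T /C /D le_eqVlt; apply/orP; left; apply/eqP; field.
  by rewrite gt_eqF.
rewrite sumT A2.
have -> : a * g / 2 * (s ^+ 2 * (A `^ (- p) / N)) =
    A `^ (- p) * (a * g / 2 * (s ^+ 2 / N)) by ring.
rewrite -mulrDr [leRHS]mulrC ler_wpM2l ?powR_ge0//.
have q0 : 0 <= s ^+ 2 / N by rewrite divr_ge0 ?sqr_ge0 ?(ltW N0).
have qe : s ^+ 2 / N <= e by rewrite ler_pdivrMr.
move: q0 qe; set q := s ^+ 2 / N => q0 qe.
have nb : 2 * n%:R * b * q <= a * g / 2.
  by apply: le_trans ne; rewrite ler_wpM2l// !mulr_ge0// ltW.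
have : 0 <= q * (a * g / 2 - 2 * n%:R * b * q).
  by rewrite mulr_ge0// subr_ge0.
lra.
Qed.

Lemma riesz_kernelE (R : realType) (n : nat) (p : R) (x y : 'rV[R]_n) :
  0 < p -> riesz_kernel p x y =
    if enorm (x - y) == 0 then +oo%E else (enorm (x - y) `^ (- p))%:E.
Proof.
move=> p0; rewrite /riesz_kernel inver powR_eq0 (gt_eqF p0) andbT.
by case: ifP => // _; rewrite powRN.
Qed.

Lemma riesz_kernel_ge0 (R : realType) (n : nat) (p : R) (x y : 'rV[R]_n) :
  (0 <= riesz_kernel p x y)%E.
Proof. by rewrite inve_ge0 lee_fin powR_ge0. Qed.

(** The factor [r - enorm x] vanishes on the sphere of radius [r]; this keeps
    the ball of radius [r] stable. Being 1-Lipschitz in [x], it also makes the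
    shift a small relative perturbation of every difference [x - y]. *)
Definition inward_shift (R : realType) (n : nat) (r s : R) (i : 'I_n)
    (x : 'rV[R]_n) : 'rV[R]_n :=
  x + (s * (r - enorm x)) *: delta_mx ord0 i.

Lemma inward_shiftB (R : realType) (n : nat) (r s : R) (i : 'I_n)
    (x y : 'rV[R]_n) :
  inward_shift r s i x - inward_shift r s i y =
  (x - y) + (s * (enorm y - enorm x)) *: delta_mx ord0 i.
Proof. by apply/rowP => j; rewrite !mxE; ring. Qed.

Lemma inward_shift_eball (R : realType) (n : nat) (r s : R) (i : 'I_n)
    (x : 'rV[R]_n) : `|s| <= 1 ->
  eball r x -> eball r (inward_shift r s i x).
Proof.
rewrite /eball/= => s1 xr.
apply: (le_trans (ler_enormD _ _)).
rewrite enormZ enorm_delta mulr1 normrM [`|r - _|]ger0_norm ?subr_ge0//.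
have : `|s| * (r - enorm x) <= 1 * (r - enorm x) by rewrite ler_wpM2r ?subr_ge0.
lra.
Qed.

Lemma continuous_inward_shift (R : realType) (n : nat) (r s : R) (i : 'I_n) :
  continuous (inward_shift r s i).
Proof.
have h : continuous (fun x : 'rV[R]_n => s * (r - enorm x)).
  move=> x; have FF : Filter (nbhs x) by exact: nbhs_filter.
  exact: (cvgM (cvg_cst s) (cvgB (cvg_cst r) (@continuous_enorm R n x))).
move=> x; apply: (@cvgD _ _ _ (nbhs x) _ (fun x : 'rV[R]_n => x)
  (fun x => (s * (r - enorm x)) *: delta_mx ord0 i)).
  exact: cvg_id.
have FF : Filter (nbhs x) by exact: nbhs_filter.
exact: (cvgZr_tmp (h x)).
Qed.

(** Superharmonicity seen by pairs of points: averaging the kernel over the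
    shifts of both points lowers it, strictly unless they have the same norm.
    On the diagonal the right-hand side is infinite. *)
Lemma riesz_kernel_inward_shift (R : realType) (n : nat) (p : R) :
  0 < p -> p < n%:R - 2 ->
  exists e c : R, [/\ 0 < e, e <= 1, 0 < c &
    forall (r : R) (x y : 'rV[R]_n),
    (\sum_(i < n)
       (riesz_kernel p (inward_shift r e i x) (inward_shift r e i y) +
        riesz_kernel p (inward_shift r (- e) i x) (inward_shift r (- e) i y)) +
     (c * ((enorm x - enorm y) ^+ 2 * enorm (x - y) `^ (- p - 2)))%:E
    <= (2 * n%:R)%:E * riesz_kernel p x y)%E].
Proof.
move=> p0 pn; have [e [c [e0 e1 c0 H]]] := riesz_superharmonic p0 pn.
exists e, (c * e ^+ 2); split => //; first exact: ltW.
  by rewrite mulr_gt0 ?exprn_gt0.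
move=> r x y.
have n0 : 0 < 2 * n%:R :> R by lra.
have [->|xy] := eqVneq x y.
  rewrite [riesz_kernel p y y]riesz_kernelE// subrr.
  rewrite enorm_eq0 (subrr y) eqxx.
  by rewrite gt0_muley ?lte_fin// leey.
have w0 : x - y != 0 by rewrite subr_eq0.
have A0 : 0 < enorm (x - y) by rewrite lt_def enorm_ge0 enorm_eq0 w0.
have kE (t : R) i : `|t| = e ->
    riesz_kernel p (inward_shift r t i x) (inward_shift r t i y) =
    (enorm ((x - y) + (t * (enorm y - enorm x)) *: delta_mx ord0 i)
      `^ (- p))%:E.
  move=> te; rewrite riesz_kernelE// inward_shiftB; case: ifPn => // /eqP h.
  exfalso; set d := _ *: _ in h.
  have : enorm (x - y) <= enorm (x - y + d) + enorm (- d).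
    by have := ler_enormD (x - y + d) (- d); rewrite addrK.
  rewrite h enormN /d enormZ enorm_delta mulr1 normrM te add0r.
  have := ler_dist_enorm x y; rewrite distrC => h2.
  have := ler_wpM2l (ltW e0) h2; nra.
rewrite [leRHS](_ : _ = (2 * n%:R * enorm (x - y) `^ (- p))%:E); last first.
  by rewrite riesz_kernelE// gt_eqF.
under eq_bigr => i _.
  rewrite (kE e) ?gtr0_norm// (kE (- e)) ?normrN ?gtr0_norm// -EFinD.
  rewrite mulNr scaleNr.
  over.
rewrite sumEFin -EFinD lee_fin.
apply: le_trans (H _ (e * (enorm y - enorm x)) w0 _).
  rewrite lerD2l le_eqVlt; apply/orP; left; apply/eqP; ring.
rewrite normrM gtr0_norm// ler_pM2l// distrC; exact: ler_dist_enorm.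
Qed.

(** * Borel measurability *)

Lemma continuous_borel_fun (R : realType) (n : nat) (f : 'rV[R]_n -> R) :
  continuous f -> measurable_fun setT (f : borel_space R n -> R).
Proof.
move=> /continuousP cf; apply: (measurability _ (RGenOpens.measurableE R)).
move=> _ [_ [a [b ->] <-]]; rewrite setTI; apply: sub_sigma_algebra.
exact/cf/interval_open.
Qed.

Lemma continuous_borel_map (R : realType) (n : nat)
    (f : 'rV[R]_n -> 'rV[R]_n) : continuous f ->
  measurable_fun setT (f : borel_space R n -> borel_space R n).
Proof.
move=> /continuousP cf.
apply: (@measurability _ _ (borel_space R n) (borel_space R n) setT f
  (@open 'rV[R]_n) erefl).
move=> _ [A oA <-]; rewrite setTI; apply: sub_sigma_algebra.
exact: cf.
Qed.

Lemma closed_borel (R : realType) (n : nat) (A : set 'rV[R]_n) :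
  closed A -> measurable (A : set (borel_space R n)).
Proof.
move=> cA; rewrite -[A]setCK; apply: measurableC; apply: sub_sigma_algebra.
exact: closed_openC.
Qed.

Lemma closed_eball (R : realType) (n : nat) (r : R) : closed (@eball R n r).
Proof.
have -> : @eball R n r = @enorm R n @^-1` [set t | t <= r] by [].
apply: preimage_closed; last exact: closed_le.
by move=> x _; exact: continuous_enorm.
Qed.

Lemma measurable_coord (R : realType) (n : nat) (i : 'I_n) :
  measurable_fun setT (fun x : borel_space R n => (x : 'rV[R]_n) ord0 i).
Proof. by apply: continuous_borel_fun => x; exact: coord_continuous. Qed.

(** Continuity would only give measurability for the Borel sigma-algebra of the
    product; the coordinates give it for the product sigma-algebra, as Fubini's
    theorem requires. *)
Lemma measurable_enormB (R : realType) (n : nat) :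
  measurable_fun setT (fun z : borel_space R n * borel_space R n =>
    enorm ((z.1 : 'rV[R]_n) - z.2)).
Proof.
apply: (@measurableT_comp _ _ _ _ _ _ (@Num.sqrt R)).
  by apply: continuous_measurable_fun; exact: sqrt_continuous.
apply: measurable_sum => i; apply: measurable_funX.
rewrite (_ : (fun _ => _) = (fun z : borel_space R n * borel_space R n =>
  (z.1 : 'rV[R]_n) ord0 i - (z.2 : 'rV[R]_n) ord0 i)); last first.
  by apply/funext => z; rewrite !mxE.
apply: measurable_funB.
- exact: (measurableT_comp (measurable_coord i) measurable_fst).
- exact: (measurableT_comp (measurable_coord i) measurable_snd).
Qed.

Lemma measurable_riesz_kernel (R : realType) (n : nat) (p : R) : 0 < p ->
  measurable_fun setT (fun z : borel_space R n * borel_space R n =>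
    riesz_kernel p (z.1 : 'rV[R]_n) z.2).
Proof.
move=> p0; under eq_fun do rewrite riesz_kernelE//.
apply: measurable_fun_ifT.
- apply: measurable_fun_eqr => //; exact: measurable_enormB.
- exact: measurable_cst.
- apply/measurable_EFinP.
  exact: (measurableT_comp (@measurable_powR R (- p)) (@measurable_enormB R n)).
Qed.

(** * Probability measures: full sets and iterated integrals *)

Local Open Scope ereal_scope.

Lemma probability_full_subset d (T : measurableType d) (R : realType)
    (P : probability T R) (A B : set T) :
  measurable A -> measurable B -> A `<=` B -> P A = 1 -> P B = 1.
Proof.
move=> mA mB AB PA; apply/eqP; rewrite eq_le probability_le1//= -[leLHS]PA.
by apply: le_measure; rewrite ?inE.
Qed.

Lemma ae_probability1 d (T : measurableType d) (R : realType)
    (P : probability T R) (A : set T) :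
  measurable A -> {ae P, forall x, A x} -> P A = 1.
Proof.
move=> mA [N [mN PN AN]].
have PCN : P (~` N) = 1.
  by apply: (eq_trans (probability_setC P mN)); rewrite PN sube0.
apply: (probability_full_subset (measurableC mN) mA _ PCN) => x Nx.
by apply: contrapT => Ax; apply: Nx; exact: AN.
Qed.

Lemma ae_exists d (T : measurableType d) (R : realType) (P : probability T R)
    (Q : T -> Prop) : {ae P, forall x, Q x} -> exists x, Q x.
Proof.
move=> [N [mN PN QN]]; apply: contrapT => /forallNP nQ.
have NT : N = setT by rewrite -subTset => x _; apply: QN; exact: nQ.
by move: PN; rewrite NT probability_setT => /eqP; rewrite onee_eq0.
Qed.

Lemma ae_imply d (T : measurableType d) (R : realType) (P : probability T R)
    (A B : T -> Prop) :
  (forall x, A x -> B x) -> {ae P, forall x, A x} -> {ae P, forall x, B x}.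
Proof. by move=> AB; apply: filterS. Qed.

Lemma ae_and d (T : measurableType d) (R : realType) (P : probability T R)
    (A B : T -> Prop) :
  {ae P, forall x, A x} -> {ae P, forall x, B x} ->
  {ae P, forall x, A x /\ B x}.
Proof. by move=> PA PB; exact: filterI PA PB. Qed.

Lemma integral_full_set d (T : measurableType d) (R : realType)
    (P : probability T R) (A : set T) (f : T -> \bar R) :
  measurable A -> P A = 1 -> measurable_fun setT f -> (forall x, 0 <= f x) ->
  \int[P]_(x in A) f x = \int[P]_x f x.
Proof.
move=> mA PA mf f0; rewrite [RHS](@ge0_negligible_integral _ _ _ _ _ (~` A))//.
- by rewrite setTD setCK.
- exact: measurableC.
- by apply: (eq_trans (probability_setC P mA)); rewrite PA subee.
Qed.

Lemma ge0_iterated_integral_eq0 d (T : measurableType d) (R : realType)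
    (P : probability T R) (f : T * T -> \bar R) :
  measurable_fun setT f -> (forall z, 0 <= f z) ->
  \int[P]_x \int[P]_y f (x, y) = 0 ->
  exists x, {ae P, forall y, f (x, y) = 0}.
Proof.
move=> mf f0 If0.
have F0 x : 0 <= \int[P]_y f (x, y) by apply: integral_ge0 => y _; exact: f0.
have /ae_exists[x fx] : {ae P, forall x, \int[P]_y f (x, y) = 0}.
  suff /ae_eq_integral_abs : \int[P]_x `|\int[P]_y f (x, y)| = 0.
    move=> /(_ measurableT (measurable_fun_fubini_tonelli_F _ mf f0)).
    by apply: filterS => x; exact.
  by under eq_integral do rewrite gee0_abs//.
exists x.
suff /ae_eq_integral_abs : \int[P]_y `|f (x, y)| = 0.
  move=> /(_ measurableT (measurableT_comp mf (measurable_pair1 _))).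
  by apply: filterS => y; exact.
by under eq_integral do rewrite gee0_abs//.
Qed.

(** An upper bound [H] for [\sum_i F i + G] leaves no room for [G] as soon as
    the integral of [H] is finite and not greater than the sum of those of
    the [F i]. *)
Lemma ge0_integral_defect_eq0 d (T : measurableType d) (R : realType)
    (m : {measure set T -> \bar R}) (n : nat) (a : R) (F : 'I_n -> T -> \bar R)
    (G H : T -> \bar R) :
  (forall i, measurable_fun setT (F i)) -> (forall i x, 0 <= F i x) ->
  measurable_fun setT G -> (forall x, 0 <= G x) ->
  measurable_fun setT H ->
  (forall x, \sum_(i < n) F i x + G x <= H x) ->
  \int[m]_x H x = (n%:R * a)%:E -> (forall i, a%:E <= \int[m]_x F i x) ->
  \int[m]_x G x = 0.
Proof.
move=> mF F0 mG G0 mH FGH IH IF.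
apply/eqP; rewrite eq_le; apply/andP; split; last exact: integral_ge0.
have IF' : (n%:R * a)%:E <= \int[m]_x (\sum_(i < n) F i x).
  rewrite ge0_integral_sum//.
  have -> : (n%:R * a)%:E = \sum_(i < n) a%:E.
    by rewrite sumEFin sumr_const card_ord mulr_natl.
  by apply: lee_sum => i _; exact: IF.
have : \int[m]_x (\sum_(i < n) F i x) + \int[m]_x G x <= (n%:R * a)%:E.
  rewrite -IH -ge0_integralD//; last 2 first.
  - by move=> x _; apply: sume_ge0.
  - exact: emeasurable_sum.
  apply: ge0_le_integral => //.
  - by move=> x _; rewrite adde_ge0// sume_ge0.
  - by apply: emeasurable_funD => //; exact: emeasurable_sum.
move=> /(le_trans (leeD IF' (lexx (\int[m]_x G x)))).
by rewrite -[leRHS]adde0 leeD2lE.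
Qed.

(** * The energy of push-forwards *)

Section energy.
Variables (R : realType) (n : nat) (p : R).
Hypothesis p0 : (0 < p)%R.
Local Notation E := (borel_space R n).
Local Notation k x y := (riesz_kernel p (x : 'rV[R]_n) (y : 'rV[R]_n)).
Implicit Types (mu : probability E R) (K : set 'rV[R]_n).

Lemma riesz_kernelZ (a : R) (x y : 'rV[R]_n) : (0 < a)%R ->
  k (a *: x) (a *: y) = (a `^ (- p))%:E * k x y.
Proof.
move=> a0; rewrite !riesz_kernelE// -scalerBr enormZ gtr0_norm//.
rewrite mulf_eq0 gt_eqF//=.
case: ifPn => _; first by rewrite gt0_muley// lte_fin powR_gt0.
by rewrite -EFinM powRM ?(ltW a0) ?enorm_ge0.
Qed.

Lemma measurable_riesz_kernel2 (x : E) :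
  measurable_fun setT (fun y : E => k x y).
Proof.
pose f (z : E * E) := k z.1 z.2.
rewrite -[fun y => _]/(f \o pair x); apply: measurableT_comp.
  exact: measurable_riesz_kernel.
exact: pair1_measurable.
Qed.

Lemma measurable_riesz_potential mu :
  measurable_fun setT (fun x : E => \int[mu]_y k x y).
Proof.
pose f (z : E * E) := k z.1 z.2.
have f0 z : 0 <= f z by exact: riesz_kernel_ge0.
have mf : measurable_fun setT f by exact: measurable_riesz_kernel.
exact: (@measurable_fun_fubini_tonelli_F _ _ _ _ _ mu f mf f0).
Qed.

Lemma riesz_potential_ge0 mu (x : E) : 0 <= \int[mu]_y k x y.
Proof. by apply: integral_ge0 => y _; exact: riesz_kernel_ge0. Qed.

Lemma riesz_integral_full_set K mu : closed K -> prob_on K mu ->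
  riesz_integral p K mu = \int[mu]_x \int[mu]_y k x y.
Proof.
move=> /closed_borel mK muK; rewrite /riesz_integral.
have k0 (x y : E) : 0 <= k x y by exact: riesz_kernel_ge0.
rewrite -(integral_full_set mK muK (measurable_riesz_potential mu)
  (riesz_potential_ge0 mu)).
apply: eq_integral => x _.
exact: (integral_full_set mK muK (measurable_riesz_kernel2 x) (k0 x)).
Qed.

(** The push-forward of [mu] under [f] is a competitor in the definition of the
    energy of [K]. *)
Lemma riesz_energy_le_pushforward K mu (f : 'rV[R]_n -> 'rV[R]_n) :
  closed K -> continuous f -> mu (f @^-1` K) = 1 ->
  riesz_energy p K <= \int[mu]_x \int[mu]_y k (f x) (f y).
Proof.
move=> cK cf Kf.
have mf := continuous_borel_map cf.
pose F : {mfun E >-> E} := HB.pack f (isMeasurableFun.Build _ _ _ _ _ mf).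
pose nu : probability E R := distribution mu F.
have nuK : prob_on K nu by exact: Kf.
have k0 (x y : E) : 0 <= k x y by exact: riesz_kernel_ge0.
have -> : \int[mu]_x \int[mu]_y k (f x) (f y) = riesz_integral p K nu.
  rewrite (riesz_integral_full_set cK nuK).
  rewrite [RHS](ge0_integral_distribution F (measurable_riesz_potential nu)
    (riesz_potential_ge0 nu)).
  apply: eq_integral => x _ /=.
  by rewrite [RHS](ge0_integral_distribution F (measurable_riesz_kernel2 (f x))
    (k0 (f x))).
by apply: ereal_inf_lbound; exists nu.
Qed.

Lemma measurable_riesz_kernel_comp (f : 'rV[R]_n -> 'rV[R]_n) : continuous f ->
  measurable_fun setT (fun z : E * E => k (f z.1) (f z.2)).
Proof.
move=> /continuous_borel_map mf.
pose h (z : E * E) := k z.1 z.2.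
pose F (z : E * E) : E * E := (f z.1, f z.2).
rewrite -[fun z => _]/(h \o F); apply: measurableT_comp.
  exact: measurable_riesz_kernel.
apply/measurable_fun_pairP; split.
- exact: (measurableT_comp mf measurable_fst).
- exact: (measurableT_comp mf measurable_snd).
Qed.

Lemma double_integral_riesz_kernel (nu : probability E R)
    (f : 'rV[R]_n -> 'rV[R]_n) : continuous f ->
  \int[(nu \x nu)%E]_z k (f z.1) (f z.2) = \int[nu]_x \int[nu]_y k (f x) (f y).
Proof.
move=> cf; pose h (z : E * E) := k (f z.1) (f z.2).
have h0 z : 0 <= h z by exact: riesz_kernel_ge0.
exact: (fubini_tonelli1 h (measurable_riesz_kernel_comp cf) h0).
Qed.

End energy.

Lemma riesz_energy_lty (R : realType) (n : nat) (p : R) (K : set 'rV[R]_n) :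
  (0 < p)%R -> 0 < riesz_capacity p K -> riesz_energy p K < +oo.
Proof.
move=> p0; rewrite /riesz_capacity ltNge => cap; rewrite ltNge; apply/negP.
rewrite leye_eq => /eqP h; move/negP: cap; apply.
by rewrite h poweRyr ?gt_eqF ?invr_gt0// invey.
Qed.

(** * The equilibrium measure of a ball *)

Section ball_equilibrium.
Variables (R : realType) (n : nat) (p : R).
Hypotheses (p0 : (0 < p)%R) (pn : (p < n%:R - 2)%R).
Local Notation E := (borel_space R n).
Local Notation k x y := (riesz_kernel p (x : 'rV[R]_n) (y : 'rV[R]_n)).

Lemma riesz_energy_eball_gt0 (r : R) (nu : probability E R) :
  equilibrium_measure p (@eball R n r) nu -> 0 < riesz_energy p (@eball R n r).
Proof.
move=> [nuB <-]; rewrite (riesz_integral_full_set p0 (@closed_eball R n r) nuB).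
pose h (z : E * E) := k z.1 z.2.
have mh : measurable_fun setT h by exact: measurable_riesz_kernel.
have h0 z : 0 <= h z by exact: riesz_kernel_ge0.
rewrite lt_def; apply/andP; split; last first.
  by apply: integral_ge0 => x _; exact: riesz_potential_ge0.
apply/eqP => /(ge0_iterated_integral_eq0 mh h0)[x /ae_exists[y]].
rewrite /h/= riesz_kernelE//; case: ifPn => // xy /eqP.
rewrite eqe powR_eq0 (negPf xy)//.
Qed.

(** Each of the [2 n] push-forwards under inward shifts has at least the energy
    of [nu], while the sum of their energies is at most [2 n] times that of [nu]
    minus the integral of a multiple of [(|x| - |y|)^2 |x - y| `^ (- p - 2)]. *)
Lemma equilibrium_eball_norm_cst (r : R) (nu : probability E R) :
  equilibrium_measure p (@eball R n r) nu ->
  riesz_energy p (@eball R n r) < +oo ->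
  exists s : R, {ae nu, forall x, enorm (x : 'rV[R]_n) = s}.
Proof.
move=> [nuB nuI] Ioo.
have [e [c [e0 e1 c0 kT]]] := riesz_kernel_inward_shift p0 pn.
pose B := @eball R n r.
have mB : measurable (B : set E) by apply: closed_borel; exact: closed_eball.
set I := riesz_energy p B in nuI Ioo.
have I0 : 0 <= I.
  rewrite -nuI /riesz_integral; do 2 (apply: integral_ge0 => ? _).
  exact: riesz_kernel_ge0.
have IE : \int[(nu \x nu)%E]_z k z.1 z.2 = I.
  rewrite -nuI (riesz_integral_full_set p0 (@closed_eball R n r) nuB).
  exact: (@double_integral_riesz_kernel _ _ _ p0 nu id (fun x => cvg_id)).
pose T s i (z : E * E) := k (inward_shift r s i z.1) (inward_shift r s i z.2).
have mT s i : measurable_fun setT (T s i : E * E -> \bar R).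
  exact: (measurable_riesz_kernel_comp p0 (@continuous_inward_shift R n r s i)).
have T0 s i z : 0 <= T s i z by exact: riesz_kernel_ge0.
have IT s i : (`|s| <= 1)%R -> I <= \int[(nu \x nu)%E]_z T s i z.
  move=> s1; rewrite /T.
  rewrite (double_integral_riesz_kernel p0 nu
    (@continuous_inward_shift R n r s i)).
  apply: (riesz_energy_le_pushforward p0 (@closed_eball R n r)).
    exact: continuous_inward_shift.
  apply: (probability_full_subset mB _ _ nuB).
  - rewrite -[_ @^-1` _]setTI.
    exact: (continuous_borel_map (@continuous_inward_shift R n r s i)).
  - by move=> x; exact: inward_shift_eball.
pose g (z : E * E) :=
  (c * ((enorm (z.1 : 'rV[R]_n) - enorm (z.2 : 'rV[R]_n)) ^+ 2 *
        enorm ((z.1 : 'rV[R]_n) - z.2) `^ (- p - 2)))%R.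
have mg : measurable_fun setT (EFin \o g).
  have me : measurable_fun setT (@enorm R n : E -> R).
    by apply: continuous_borel_fun; exact: continuous_enorm.
  apply/measurable_EFinP; apply: measurable_funM; first exact: measurable_cst.
  apply: measurable_funM.
    apply: measurable_funX; apply: measurable_funB.
    - exact: (measurableT_comp me measurable_fst).
    - exact: (measurableT_comp me measurable_snd).
  exact: (measurableT_comp (@measurable_powR R (- p - 2))
    (@measurable_enormB R n)).
have g0 z : 0 <= (EFin \o g) z.
  by rewrite /= lee_fin mulr_ge0 ?(ltW c0)// mulr_ge0 ?sqr_ge0// powR_ge0.
(* The second-order defect [g] integrates to [0] by minimality. *)
have : \int[(nu \x nu)%E]_z (EFin \o g) z = 0.
  have mk : measurable_fun setT (fun z : E * E => k z.1 z.2).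
    exact: measurable_riesz_kernel.
  have Ifin : I \is a fin_num by rewrite ge0_fin_numE.
  have IfinE := fineK Ifin.
  have IT2 i : (2 * fine I)%:E <=
      \int[(nu \x nu)%E]_z (T e i z + T (- e)%R i z).
    rewrite (ge0_integralD _ measurableT (fun z _ => T0 e i z) (mT e i)
      (fun z _ => T0 (- e)%R i z) (mT (- e)%R i)).
    rewrite mulrDl mul1r EFinD IfinE.
    by apply: leeD; apply: IT; rewrite ?normrN gtr0_norm.
  have IH : \int[(nu \x nu)%E]_z ((2 * n%:R)%:E * k z.1 z.2) =
      (n%:R * (2 * fine I))%:E.
    rewrite (ge0_integralZl_EFin _ measurableT _ mk); last 2 first.
    - by move=> z _; exact: riesz_kernel_ge0.
    - by rewrite mulr_ge0.
    by rewrite IE -IfinE -EFinM; congr EFin; ring.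
  apply: (ge0_integral_defect_eq0 _ _ mg g0 _ _ IH IT2).
  - by move=> i; apply: emeasurable_funD; exact: mT.
  - by move=> i z; rewrite adde_ge0 ?T0.
  - exact: measurable_funeM.
  - by move=> z; exact: kT.
have -> : \int[(nu \x nu)%E]_z (EFin \o g) z =
    \int[nu]_x \int[nu]_y (EFin \o g) (x, y).
  exact: (fubini_tonelli1 (EFin \o g) mg g0).
move=> /(ge0_iterated_integral_eq0 mg g0)[x gx].
exists (enorm (x : 'rV[R]_n)); apply: filterS gx => y /= [] /eqP.
rewrite mulf_eq0 (gt_eqF c0)/= mulf_eq0 sqrf_eq0 powR_eq0 enorm_eq0 !subr_eq0.
by case/orP => [/eqP ->//|/andP[/eqP ->]].
Qed.

(** The shifts translate a sphere rigidly, so they do not detect its radius;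
    the dilation by [r / t] does, since it multiplies the energy by
    [(r / t) `^ (- p)]. Taking [t] at least [r / 2] avoids dividing by a radius
    that is not yet known to be positive. *)
Lemma equilibrium_eball_sphere (r : R) (nu : probability E R) : (0 < r)%R ->
  equilibrium_measure p (@eball R n r) nu ->
  riesz_energy p (@eball R n r) < +oo ->
  {ae nu, forall x, enorm (x : 'rV[R]_n) = r}.
Proof.
move=> r0 nuE Ioo; have [s nus] := equilibrium_eball_norm_cst nuE Ioo.
have [nuB nuI] := nuE.
have mball t : measurable (@eball R n t : set E).
  by apply: closed_borel; exact: closed_eball.
have I0 := riesz_energy_eball_gt0 nuE.
(* Otherwise the dilation by [a = r / t > 1] is admissible and lowers the
   energy. *)
have sr : (r <= s)%R.
  rewrite leNgt; apply/negP => sr.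
  pose t : R := (Num.max s (r / 2))%R.
  have t0 : (0 < t)%R by rewrite /t lt_max divr_gt0 ?orbT.
  have tr : (t < r)%R by rewrite /t gt_max sr/= gtr_pMr// invf_lt1// ltr1n.
  pose a := (r / t)%R.
  have a1 : (1 < a)%R by rewrite ltr_pdivlMr// mul1r.
  have a0 : (0 < a)%R by rewrite divr_gt0.
  have cf : continuous (fun x : 'rV[R]_n => a *: x).
    by move=> x; exact: scaler_continuous.
  have nut : nu (@eball R n t) = 1.
    apply: ae_probability1; first exact: mball.
    suff : {ae nu, forall x, enorm (x : 'rV[R]_n) <= t}%R by [].
    by apply: ae_imply nus => x ->; rewrite /t le_max lexx.
  have nuf : nu ((fun x : 'rV[R]_n => a *: x) @^-1` @eball R n r) = 1.
    apply: (probability_full_subset (mball t) _ _ nut).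
      rewrite -[_ @^-1` _]setTI.
      exact: (continuous_borel_map cf measurableT (mball r)).
    move=> x; rewrite /eball/= enormZ gtr0_norm// /a mulrAC ler_pdivrMr// => xt.
    by rewrite ler_pM2l.
  have := riesz_energy_le_pushforward p0 (@closed_eball R n r) cf nuf.
  have -> : \int[nu]_x \int[nu]_y
        k (a *: (x : 'rV[R]_n)) (a *: (y : 'rV[R]_n)) =
      (a `^ (- p))%:E * riesz_energy p (@eball R n r).
    rewrite -nuI (riesz_integral_full_set p0 (@closed_eball R n r) nuB).
    rewrite -(ge0_integralZl_EFin _ measurableT
      (fun x _ => riesz_potential_ge0 p nu x) (measurable_riesz_potential p0 nu)
      (powR_ge0 _ _)).
    apply: eq_integral => x _.
    rewrite -(ge0_integralZl_EFin _ measurableT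
      (fun (y : E) _ => riesz_kernel_ge0 p x y) (measurable_riesz_kernel2 p0 x)
      (powR_ge0 _ _)).
    by apply: eq_integral => y _; exact: riesz_kernelZ.
  have Ifin : riesz_energy p (@eball R n r) \is a fin_num.
    by rewrite ge0_fin_numE ?ltW.
  move: I0; rewrite -(fineK Ifin) -EFinM lte_fin lee_fin => I0.
  rewrite powRN -ler_pdivrMr// divff ?gt_eqF// leNgt => /negP; apply.
  have ap : (1 < a `^ p)%R.
    have : (1 `^ p < a `^ p)%R.
      by apply: gt0_ltr_powR; rewrite // nnegrE// ltW.
    by rewrite powR1.
  by rewrite invf_lt1// (lt_trans _ ap).
have nuBs : {ae nu, forall x, (enorm (x : 'rV[R]_n) <= r)%R}.
  exists (~` (@eball R n r : set E)); split => //; first exact: measurableC.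
  by apply: (eq_trans (probability_setC nu (mball r))); rewrite nuB subee.
have [x [xs xr]] := ae_exists (ae_and nus nuBs).
have -> : r = s by apply/eqP; rewrite eq_le sr -xs.
exact: nus.
Qed.

End ball_equilibrium.

(** * Moments *)

Section moments.
Variables (R : realType) (n : nat).
Local Notation E := (borel_space R n).
Implicit Types (mu nu : probability E R) (K : set 'rV[R]_n).

Lemma measurable_enorm_powR (q : R) :
  measurable_fun setT (fun x : E => (enorm (x : 'rV[R]_n) `^ q)%:E).
Proof.
apply/measurable_EFinP.
apply: (@measurableT_comp _ _ _ _ _ _ (@powR R ^~ q)).
  exact: measurable_powR.
by apply: continuous_borel_fun; exact: continuous_enorm.
Qed.

Lemma enorm_powR_ge0 (q : R) (x : E) : 0 <= (enorm (x : 'rV[R]_n) `^ q)%:E.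
Proof. by rewrite lee_fin powR_ge0. Qed.

Lemma moment_full_set K mu (q : R) : closed K -> prob_on K mu ->
  moment q K mu = \int[mu]_x (enorm (x : 'rV[R]_n) `^ q)%:E.
Proof.
move=> /closed_borel mK muK.
exact: (integral_full_set mK muK (measurable_enorm_powR q) (enorm_powR_ge0 q)).
Qed.

Lemma moment_sphere K mu (q r : R) : closed K -> prob_on K mu ->
  {ae mu, forall x, enorm (x : 'rV[R]_n) = r} -> moment q K mu = (r `^ q)%:E.
Proof.
move=> cK muK mur; rewrite moment_full_set//.
have -> : \int[mu]_x (enorm (x : 'rV[R]_n) `^ q)%:E = \int[mu]_x (r `^ q)%:E.
  apply: ge0_ae_eq_integral => //.
  - exact: measurable_enorm_powR.
  - by move=> x _; exact: enorm_powR_ge0.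
  - by move=> x _; rewrite lee_fin powR_ge0.
  - by apply: ae_imply mur => x -> _.
by rewrite integral_cst// [X in _ * X]probability_setT mule1.
Qed.

(** Jensen's inequality for the convex function [t `^ (b / a)], by integrating
    Young's inequality. The subtracted constant of the tangent line is kept on the side
    of [t `^ b], so that all the integrands are nonnegative. *)
Lemma moment_ge_powR K mu (a b r : R) : closed K -> prob_on K mu ->
  (0 < a)%R -> (a <= b)%R -> (0 < r)%R ->
  (r `^ a)%:E <= moment a K mu -> (r `^ b)%:E <= moment b K mu.
Proof.
move=> cK muK a0; rewrite le_eqVlt => /predU1P[-> //|ab] r0.
rewrite !moment_full_set// => ra.
have m0 : (0 <= b / a - 1)%R by rewrite subr_ge0 ler_pdivlMr// mul1r ltW.
have C0 : (0 <= b / a * r `^ (b - a))%R.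
  by rewrite mulr_ge0 ?powR_ge0// divr_ge0// ltW// (lt_trans a0).
pose C := ((b / a - 1) * r `^ b)%R.
have C'0 : (0 <= C)%R by rewrite mulr_ge0// powR_ge0.
suff : (r `^ b + C)%:E <= \int[mu]_x (enorm (x : 'rV[R]_n) `^ b)%:E + C%:E.
  by rewrite EFinD leeD2rE.
have -> : \int[mu]_x (enorm (x : 'rV[R]_n) `^ b)%:E + C%:E =
    \int[mu]_x ((enorm (x : 'rV[R]_n) `^ b)%:E + C%:E).
  rewrite (ge0_integralD _ measurableT (fun x _ => enorm_powR_ge0 b x)
    (measurable_enorm_powR b) _ (measurable_cst _)); last first.
    by move=> x _; rewrite lee_fin.
  by rewrite integral_cst// [X in _ = _ + _ * X]probability_setT mule1.
have -> : (r `^ b + C = b / a * r `^ (b - a) * r `^ a)%R.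
  rewrite -mulrA -powRD; last by rewrite (gt_eqF r0) implybT.
  by rewrite subrK /C; ring.
apply: (@le_trans _ _ ((b / a * r `^ (b - a))%:E *
    \int[mu]_x (enorm (x : 'rV[R]_n) `^ a)%:E)).
  by rewrite EFinM lee_wpmul2l// lee_fin.
rewrite -(ge0_integralZl_EFin _ measurableT (fun x _ => enorm_powR_ge0 a x)
  (measurable_enorm_powR a) C0).
apply: ge0_le_integral => //.
- by move=> x _; rewrite -EFinM lee_fin mulr_ge0// powR_ge0.
- by apply: measurable_funeM; exact: measurable_enorm_powR.
- by apply: emeasurable_funD => //; exact: measurable_enorm_powR.
- move=> x _; rewrite -EFinM -EFinD lee_fin.
  by apply: powR_young => //; exact: enorm_ge0.
Qed.

End moments.

Unset Implicit Arguments.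

Theorem proposition1p5 (R : realType) (n : nat) (p : R)
  (hn : (3 <= n)%N) (hp0 : (0 < p)%R) (hpn : (p < n%:R - 2)%R)
  (K : set 'rV[R]_n) (hK : compact K) (r : R) (hr : (0 < r)%R)
  (hcap : riesz_capacity p K = riesz_capacity p (@eball R n r))
  (hpos : 0 < riesz_capacity p (@eball R n r))
  (mu nu : probability (borel_space R n) R)
  (hmu : equilibrium_measure p K mu)
  (hnu : equilibrium_measure p (@eball R n r) nu)
  (qs : R) (hqs : (0 < qs)%R)
  (hmoment : moment qs (@eball R n r) nu <= moment qs K mu) :
  forall q : R, (qs <= q)%R -> moment q (@eball R n r) nu <= moment q K mu.
Proof.
move=> q qsq.
have cK : closed K by apply: compact_closed => //; exact: norm_hausdorff.
have [muK _] := hmu; have [nuB _] := hnu.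
have nur := equilibrium_eball_sphere hp0 hpn hr hnu (riesz_energy_lty hp0 hpos).
have nuE t := moment_sphere t (@closed_eball R n r) nuB nur.
rewrite nuE; apply: (moment_ge_powR cK muK hqs qsq hr).
by rewrite -nuE.
Qed.
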